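(* Let $G$ be a finite connected undirected graph (multiple edges and loops allowed) with $n=|V(G)|$ vertices. The number of strongly connected partial orientations of $G$ is $2^{n-1}\,T_G(1/2,3)$, where $T_G(x,y)$ is the Tutte polynomial of $G$.
   Context: A partial orientation of $G$ is an orientation of a subset of the edges; the remaining edges are unoriented. Thus each edge (including each loop) is in one of three states: oriented in one of two directions, or unoriented. A directed cut in a partial orientation is the set of all edges between $X$ and $X^c=V(G)\setminus X$, for some $\emptyset\neq X\subsetneq V(G)$, such that every one of these edges is oriented, and all are oriented from $X$ to $X^c$. A partial orientation is strongly connected if it does not contain any directed cut. *)

(* Defs.v *)
From mathcomp Require Import all_boot all_order all_algebra.

Set Implicit Arguments.
Unset Strict Implicit.
Unset Printing Implicit Defensive.

Import GRing.Theory.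
Local Open Scope ring_scope.

(* The order of the two ends of an edge is an arbitrary labelling of its two
   half-edges: it serves only to name the two directions of the edge, which
   remain distinct for a loop. *)
Record multigraph := Multigraph {
  vertex : finType;
  edge : finType;
  end1 : edge -> vertex;
  end2 : edge -> vertex
}.

Section Multigraph.
Variable G : multigraph.
Implicit Types (A C : {set edge G}) (X : {set vertex G}).

Definition adjacent A : rel (vertex G) := fun u v =>
  [exists e in A, ((end1 e == u) && (end2 e == v))
               || ((end1 e == v) && (end2 e == u))].

Definition connected : bool :=
  (0 < #|vertex G|)%N && [forall u, forall v, connect (adjacent setT) u v].

Definition num_components A : nat := n_comp (adjacent A) (vertex G).

Definition rank A : nat := (#|vertex G| - num_components A)%N.

(* 'X is the outer variable, so that (tutte_poly G R).[x, y] is T_G(x, y).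
   Both truncated differences are exact, as rank A <= rank setT, #|A|. *)
Definition tutte_poly (R : comNzRingType) : {poly {poly R}} :=
  \sum_(A : {set edge G})
    ('X - 1) ^+ (rank setT - rank A) * ('Y - 1) ^+ (#|A| - rank A).

(* None: unoriented; Some true: from end1 to end2; Some false: from end2 to
   end1. *)
Definition partial_orientation := {ffun edge G -> option bool}.

Implicit Type o : partial_orientation.

Definition arc o (e : edge G) : option (vertex G * vertex G) :=
  omap (fun b : bool => if b then (end1 e, end2 e) else (end2 e, end1 e)) (o e).

Definition cut X : {set edge G} :=
  [set e | (end1 e \in X) != (end2 e \in X)].

Definition oriented_out o X (e : edge G) : bool :=
  if arc o e is Some (u, v) then (u \in X) && (v \notin X) else false.

Definition directed_cut o C : bool :=
  [exists X : {set vertex G},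
    [&& X != set0, X \proper [set: vertex G], C == cut X
      & [forall e in C, oriented_out o X e]]].

Definition strongly_connected o : bool :=
  ~~ [exists C : {set edge G}, directed_cut o C].

End Multigraph.

Arguments tutte_poly G R : clear implicits.
Arguments connected G : clear implicits.
Arguments partial_orientation G : clear implicits.

(* Main.v *)
Require Import Defs.
From mathcomp Require Import all_boot all_order all_algebra.
From mathcomp Require Import zify.
Local Open Scope ring_scope.

(** Write k(A) for the number of components of (V, A).  Substituting x = 1/2
    and y = 3 in the subset expansion of the Tutte polynomial, the powers of 2
    collapse to |A| and the claim becomes

      #{strongly connected partial orientations}
        = - \sum_A 2^|A| (-1)^k(A)                                      (1)

    Read a partial orientation as a digraph in which an unoriented edge can be
    traversed both ways; a directed cut is then a set of vertices that no arc
    enters, so strongly connected has its usual meaning.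

    Give a relation r on V the sign psi(r) = (-1)^(number of classes) if
    reachability under r is symmetric, and 0 otherwise.  This is the Moebius
    number of the lattice of r-closed sets, and it satisfies the valuation
    identity (class_sign_valuation)

      psi(r + uv) + psi(r + vu) = psi(r) + psi(r + uv + vu).

    Adding psi(r + uv + vu) to both sides: summing psi over the three states
    uv, vu, both of an edge gives the same as summing it over the three states
    absent, both, both.  Applying this to one edge after another
    (sum_mixed_step) turns the sum of psi over all partial orientations into
    the sum over all A of 2^|A| psi(A), because each edge of A carries two
    labels; and psi(A) = (-1)^k(A), as A is traversed both ways.  On the other
    hand, when G is connected, an orientation with symmetric reachability has
    a single class, so psi of a partial orientation is -1 if it is strongly
    connected and 0 otherwise.  Comparing the two sums yields (1). *)

Set Implicit Arguments.
Unset Strict Implicit.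
Unset Printing Implicit Defensive.
Import GRing.Theory.

(** * Reachability after adding arcs, and the signed class count *)

Section Reachability.
Variable T : finType.
Implicit Types (r : rel T) (u v x y : T) (a b : bool).

Definition add_arcs r u v a b : rel T := fun x y =>
  [|| r x y, a && (x == u) && (y == v) | b && (x == v) && (y == u)].

(** A walk may be shortened so as to use at most one of the two new arcs, and
    at most once, since two uses make it visit u or v twice. *)
Lemma connect_add_arcs r u v a b x y :
  connect (add_arcs r u v a b) x y =
  [|| connect r x y, a && connect r x u && connect r v y
    | b && connect r x v && connect r u y].
Proof.
have sub z t : connect r z t -> connect (add_arcs r u v a b) z t.
  by apply: connect_sub => {z t} z t rzt; rewrite connect1 ?/add_arcs ?rzt.
apply/idP/idP=> [/connectP[p] | ].
  elim: p x => [x _ -> | z p IHp x /= /andP[xz zp] /(IHp _ zp)].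
    by rewrite connect0.
  case/or3P: xz => [/connect1 xz | /andP[/andP[-> /eqP-> /eqP->]] | ].
  - case/or3P=> [zy | /andP[/andP[-> zu] ->] | /andP[/andP[-> zv] ->]].
    + by rewrite (connect_trans xz zy).
    + by rewrite (connect_trans xz zu) !orbT.
    + by rewrite (connect_trans xz zv) !orbT.
  - by rewrite !connect0 => /or3P[|/andP[_]|/andP[_]] ->; rewrite ?orbT.
  - move=> /andP[/andP[-> /eqP-> /eqP->]].
    by rewrite !connect0 => /or3P[|/andP[_]|/andP[_]] ->; rewrite ?orbT.
case/or3P=> [/sub // | /andP[/andP[ha /sub xu] /sub vy]
                     | /andP[/andP[hb /sub xv] /sub uy]].
  apply: connect_trans xu (connect_trans (connect1 _) vy).
  by rewrite /add_arcs ha !eqxx orbT.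
apply: connect_trans xv (connect_trans (connect1 _) uy).
by rewrite /add_arcs hb !eqxx !orbT.
Qed.

Lemma eq_add_arcs r r' u v a b :
  r =2 r' -> add_arcs r u v a b =2 add_arcs r' u v a b.
Proof. by move=> rr' x y; rewrite /add_arcs rr'. Qed.

Lemma connect_add_sym r u v :
  connect_sym r -> connect_sym (add_arcs r u v true true).
Proof.
move=> r_sym x y; rewrite !connect_add_arcs !andTb.
rewrite (r_sym y x) (r_sym y u) (r_sym y v) (r_sym u x) (r_sym v x).
by congr (_ || _); rewrite orbC; congr (_ || _); apply: andbC.
Qed.

(** The new arcs merge the classes of u and v, whose union a is a single
    class afterwards, and leave the classes outside a as they were. *)
Lemma n_comp_add r u v : connect_sym r ->
  n_comp r T = (n_comp (add_arcs r u v true true) T + ~~ connect r u v)%N.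
Proof.
move=> r_sym; set r' := add_arcs _ _ _ _ _.
have r'_sym : connect_sym r' by apply: connect_add_sym.
pose a := closure r (pred2 u v).
have aE z : (z \in a) = connect r z u || connect r z v.
  apply/idP/idP => [/pred0Pn[t /andP[zt tuv]] | ].
    have {zt} : connect r z t := zt.
    by case/pred2P: tuv => -> ->; rewrite ?orbT.
  case/orP=> zt; apply/pred0Pn; [exists u | exists v].
    by apply/andP; split=> //; apply/pred2P; left.
  by apply/andP; split=> //; apply/pred2P; right.
have r'E z t : connect r' z t = connect r z t || (z \in a) && (t \in a).
  rewrite connect_add_arcs !andTb !aE !(r_sym t).
  apply/idP/idP.
    by case/or3P=> [-> | /andP[-> ->] | /andP[-> ->]]; rewrite ?orbT.
  case/orP=> [-> // | /andP[] /orP[] zx /orP[] ty].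
  - by rewrite (connect_trans zx ty).
  - by rewrite zx ty orbT.
  - by rewrite zx ty !orbT.
  - by rewrite (connect_trans zx ty).
rewrite (n_compC a) [in RHS](n_compC a) n_comp_closure2 //.
have -> : n_comp r' a = 1%N.
  rewrite -(n_comp_connect r'_sym u); apply: eq_n_comp_r => z.
  rewrite -!topredE /= r'E aE connect0 /= r_sym.
  by rewrite -[a z]/(z \in a) aE; case: (connect r z u).
suff -> : n_comp r' [predC a] = n_comp r [predC a].
  by rewrite add1n !addSn addnC.
(* Outside a both relations reach the same vertices, hence choose the same
   representatives. *)
have rootE z : z \notin a -> fingraph.root r' z = fingraph.root r z.
  move=> /negPf za; rewrite /fingraph.root; congr odflt; apply: eq_pick => t.
  by rewrite r'E za orbF.
apply: eq_card => z; rewrite !inE /= /roots.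
by case: (boolP (z \in a)) => [|/rootE->]; rewrite ?andbF.
Qed.

Variable R : pzRingType.

Definition connect_symb r :=
  [forall x, forall y, connect r x y == connect r y x].

Lemma connect_symP r : reflect (connect_sym r) (connect_symb r).
Proof. by apply: (iffP 'forall_forallP) => rs x y; apply/eqP; rewrite rs. Qed.

(** The Moebius number of the lattice of r-closed subsets of T: this lattice is
    distributive, and Boolean exactly when reachability is symmetric. *)
Definition class_sign r : R :=
  if connect_symb r then (-1) ^+ n_comp r T else 0.

Lemma eq_class_sign r r' :
  connect r =2 connect r' -> class_sign r = class_sign r'.
Proof.
move=> rr'; rewrite /class_sign (eq_n_comp rr'); congr (if _ then _ else _).
by apply: eq_forallb => x; apply: eq_forallb => y; rewrite !rr'.
Qed.

(** If v is reachable from u (or conversely), one of the two arcs is redundant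
    and the two sides agree term by term.  If u and v are incomparable, a
    single arc makes reachability asymmetric, so the left side is 0; on the
    right, both terms are 0 if r is asymmetric, and otherwise they have
    opposite signs because exactly one merger of classes takes place. *)
Lemma class_sign_valuation r u v :
  class_sign (add_arcs r u v true false)
    + class_sign (add_arcs r u v false true)
  = class_sign r + class_sign (add_arcs r u v true true).
Proof.
have [uv | nuv] := boolP (connect r u v).
  have uvE z t : connect r z u && connect r v t -> connect r z t.
    by case/andP=> zu /(connect_trans uv); apply: connect_trans.
  congr (_ + _); apply: eq_class_sign => z t;
    rewrite !connect_add_arcs !andTb /= ?orbF.
    by apply/orb_idr/uvE.
  by case: (boolP (connect r z u && _)) => // /uvE ->.
have [vu | nvu] := boolP (connect r v u).
  have vuE z t : connect r z v && connect r u t -> connect r z t.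
    by case/andP=> zu /(connect_trans vu); apply: connect_trans.
  rewrite addrC; congr (_ + _); apply: eq_class_sign => z t;
    rewrite !connect_add_arcs !andTb /= ?orbF.
    by apply/orb_idr/vuE.
  case: (boolP (connect r z v && _)) => [/vuE -> //|].
  by rewrite orbF.
have -> : class_sign (add_arcs r u v true false) = 0.
  rewrite /class_sign; case: connect_symP => // /(_ u v).
  by rewrite !connect_add_arcs !connect0 (negPf nuv) (negPf nvu).
have -> : class_sign (add_arcs r u v false true) = 0.
  rewrite /class_sign; case: connect_symP => // /(_ u v).
  by rewrite !connect_add_arcs !connect0 (negPf nuv) (negPf nvu).
rewrite addr0 /class_sign.
case: (connect_symP r) => [r_sym | r_nsym].
  have /connect_symP -> := connect_add_sym u v r_sym.
  by rewrite (n_comp_add u v r_sym) nuv addn1 exprS mulN1r addNr.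
rewrite ifF ?addr0 //; apply/negP=> /connect_symP r'_sym.
(* If x reaches y but y can only return through a new arc, then closing the
   loop inside r would make u and v comparable. *)
suff r_sub x y : connect r x y -> connect r y x.
  by case: r_nsym => x y; apply/idP/idP; apply: r_sub.
move=> xy; have:= r'_sym x y; rewrite !connect_add_arcs xy /=.
case/esym/or3P=> // /andP[yz tx].
  by case/negP: nvu; apply: connect_trans tx (connect_trans xy yz).
by case/negP: nuv; apply: connect_trans tx (connect_trans xy yz).
Qed.

End Reachability.

(** * Summing over one value of a finite function at a time *)

Section FunctionUpdates.
Variables (I L : finType) (R : nmodType).

Definition update (f : {ffun I -> L}) i l : {ffun I -> L} :=
  [ffun j => if j == i then l else f j].

Lemma sum_ffun_update (F : {ffun I -> L} -> R) i l0 :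
  \sum_f F f = \sum_(f : {ffun I -> L} | f i == l0) \sum_l F (update f i l).
Proof.
rewrite pair_big_dep /=.
rewrite (reindex_onto (fun p : {ffun I -> L} * L => update p.1 i p.2)
           (fun f => (update f i l0, f i))) /=; last first.
  by move=> f _; apply/ffunP=> j; rewrite !ffunE; case: eqP => // ->.
apply: eq_bigl => -[f l]; rewrite andbT ffunE eqxx xpair_eqE eqxx andbT.
apply/eqP/eqP=> [<- | fi]; first by rewrite ffunE eqxx.
by apply/ffunP=> j; rewrite !ffunE; case: eqP => // ->.
Qed.

End FunctionUpdates.

Lemma sum_option_bool (R : nmodType) (F : option bool -> R) :
  \sum_l F l = F None + (F (Some true) + F (Some false)).
Proof.
rewrite (bigD1 None) // (bigD1 (Some true)) // (bigD1 (Some false)) //=.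
by rewrite big1 ?addr0 // => -[[]|].
Qed.

(** * Digraphs on the edges of a multigraph *)

Section Digraphs.
Variable G : multigraph.
Local Notation V := (vertex G).
Local Notation E := (edge G).
Implicit Types (s : E -> bool * bool) (A D : {set E}).
Implicit Types f : partial_orientation G.

(** The two booleans say whether an edge may be traversed from end1 to end2,
    and from end2 to end1; the same type thus covers absent, oriented and
    two-way edges. *)
Definition digraph s : rel V := fun x y =>
  [exists e, (s e).1 && (x == end1 e) && (y == end2 e)
          || (s e).2 && (x == end2 e) && (y == end1 e)].

Lemma eq_digraph s s' : s =1 s' -> digraph s =2 digraph s'.
Proof. by move=> ss' x y; apply: eq_existsb => e; rewrite ss'. Qed.

Definition drop_edge e s : E -> bool * bool :=
  fun e' => if e' == e then (false, false) else s e'.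

Lemma digraph_split e s :
  digraph s =2
  add_arcs (digraph (drop_edge e s)) (end1 e) (end2 e) (s e).1 (s e).2.
Proof.
move=> x y; rewrite /add_arcs; apply/existsP/idP => [[e' xy] | ].
  have [e'e | ne'e] := eqVneq e' e; first by rewrite -e'e xy orbT.
  by apply/orP; left; apply/existsP; exists e'; rewrite /drop_edge (negPf ne'e).
case/orP=> [/existsP[e'] | xy]; last by exists e.
by rewrite /drop_edge; case: eqP => // _ xy; exists e'.
Qed.

Lemma adjacentE A : adjacent A =2 digraph (fun e => (e \in A, e \in A)).
Proof.
move=> x y; apply: eq_existsb => e /=.
rewrite ![end1 e == _]eq_sym ![end2 e == _]eq_sym.
by case: (e \in A); rewrite //= [(y == _) && _]andbC.
Qed.

Lemma adjacent_sym A : connect_sym (adjacent A).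
Proof.
by apply: sym_connect_sym => x y; apply: eq_existsb => e; rewrite orbC.
Qed.

(** * Bounds on the number of components *)

Lemma num_components0 : num_components (set0 : {set E}) = #|V|.
Proof.
apply: eq_card => x; rewrite !inE andbT; apply/eqP.
case/connectP: (connect_root (adjacent set0) x) => -[|y p] //= /andP[].
by case/existsP=> e; rewrite inE.
Qed.

Lemma num_components_gt0 A : (0 < #|V|)%N -> (0 < num_components A)%N.
Proof.
case/card_gt0P=> x _; apply/card_gt0P; exists (fingraph.root (adjacent A) x).
by rewrite !inE /= (roots_root (adjacent_sym A)).
Qed.

Lemma num_components_le A : (num_components A <= #|V|)%N.
Proof. exact: max_card. Qed.

Lemma num_components_connected :
  connected G -> num_components [set: E] = 1%N.
Proof.
case/andP=> /card_gt0P[x _] /'forall_forallP G_conn.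
rewrite -(n_comp_connect (@adjacent_sym setT) x); apply: eq_n_comp_r => y.
by rewrite -!topredE /= G_conn.
Qed.

(** Each edge of A lowers the number of components by at most one.  This makes
    the truncated nullity |A| - rank A exact. *)
Lemma card_vertex_le A : (#|V| <= num_components A + #|A|)%N.
Proof.
have [n] := ubnP #|A|; elim: n A => // n IHn A /ltnSE leAn.
have [-> | [e eA]] := set_0Vmem A; first by rewrite num_components0 leq_addr.
have lt_A : (#|A :\ e| < #|A|)%N by rewrite [in ltnRHS](cardsD1 e) eA.
apply: leq_trans (IHn (A :\ e) (leq_trans lt_A leAn)) _.
rewrite [in leqRHS](cardsD1 e) eA addnA leq_add2r.
have -> : num_components A =
    n_comp (add_arcs (adjacent (A :\ e)) (end1 e) (end2 e) true true) V.
  apply: eq_n_comp; apply: eq_connect => x y.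
  rewrite adjacentE (digraph_split e) /= eA; apply: eq_add_arcs => {}x {}y.
  rewrite adjacentE; apply: eq_digraph => e'; rewrite /drop_edge !inE.
  by case: eqP.
rewrite {1}/num_components (n_comp_add (end1 e) (end2 e) (@adjacent_sym _)).
by rewrite leq_add2l leq_b1.
Qed.

(** * From orientations to edge subsets, one edge at a time *)

Variable R : pzRingType.

Definition directions (l : option bool) : bool * bool :=
  (l != Some false, l != Some true).

(** The second reading of the three labels: one of them removes the edge and
    two keep it, which is where the weight 2^|A| comes from. *)
Definition presence (l : option bool) : bool * bool := (isSome l, isSome l).

Definition mixed_state D f (e : E) : bool * bool :=
  if e \in D then directions (f e) else presence (f e).

(** With all labels but that of e fixed, the label of e contributes
    (both) + (uv + vu) on the left and (absent) + (both + both) on the right,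
    so this is the valuation identity at the ends of e. *)
Lemma sum_mixed_step D e : e \notin D ->
  \sum_(f : partial_orientation G)
     class_sign R (digraph (mixed_state (e |: D) f)) =
  \sum_(f : partial_orientation G) class_sign R (digraph (mixed_state D f)).
Proof.
move=> eD.
rewrite [LHS](sum_ffun_update _ e None) [RHS](sum_ffun_update _ e None).
apply: eq_bigr => f _; rewrite !sum_option_bool.
pose r := digraph (drop_edge e (mixed_state D f)).
have rE D' l : D' \in [:: D; e |: D] ->
   class_sign R (digraph (mixed_state D' (update f e l))) =
   let d := (if e \in D' then directions l else presence l) in
   class_sign R (add_arcs r (end1 e) (end2 e) d.1 d.2).
  move=> DD'; apply: eq_class_sign; apply: eq_connect => x y.
  rewrite (digraph_split e) /mixed_state ffunE eqxx.
  apply: eq_add_arcs => {}x {}y; apply: eq_digraph => e'.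
  rewrite /drop_edge ffunE; case: eqP => // /eqP ne.
  by move: DD'; rewrite !inE => /pred2P[]->; rewrite // !inE (negPf ne).
rewrite !rE ?mem_head ?inE ?eqxx ?orbT // (negPf eD) /=.
rewrite addrC class_sign_valuation addrA; congr (_ + _ + _).
apply: eq_class_sign; apply: eq_connect => x y.
by rewrite /add_arcs orbF.
Qed.

Lemma sum_mixed D :
  \sum_(f : partial_orientation G) class_sign R (digraph (mixed_state D f)) =
  \sum_(f : partial_orientation G) class_sign R (digraph (presence \o f)).
Proof.
have [n] := ubnP #|D|; elim: n D => // n IHn D /ltnSE leDn.
have [-> | [e eD]] := set_0Vmem D.
  apply: eq_bigr => f _; apply/eq_class_sign/eq_connect/eq_digraph => e.
  by rewrite /mixed_state inE.
rewrite -(setD1K eD) sum_mixed_step ?setD11 //; apply: IHn.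
by apply: leq_trans leDn; rewrite [in ltnRHS](cardsD1 e) eD.
Qed.

Lemma sum_class_sign_directions :
  \sum_(f : partial_orientation G) class_sign R (digraph (directions \o f)) =
  \sum_(f : partial_orientation G) class_sign R (digraph (presence \o f)).
Proof.
rewrite -(sum_mixed setT); apply: eq_bigr => f _.
apply/eq_class_sign/eq_connect/eq_digraph => e.
by rewrite /mixed_state inE.
Qed.

(** The sign depends on f only through the set A of edges it keeps, and 2^|A|
    labellings keep exactly A. *)
Lemma sum_class_sign_presence :
  \sum_(f : partial_orientation G) class_sign R (digraph (presence \o f)) =
  \sum_(A : {set E}) (-1) ^+ num_components A *+ 2 ^ #|A|.
Proof.
rewrite (partition_big (fun f => [set e | f e]) predT) //=.
apply: eq_bigr => A _.
transitivity (\sum_(f : partial_orientation G | [set e | f e] == A)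
   (-1) ^+ num_components A : R).
  apply: eq_bigr => f /eqP <-; rewrite /class_sign.
  have e_r :
      connect (adjacent [set e | f e]) =2 connect (digraph (presence \o f)).
    apply: eq_connect => x y; rewrite adjacentE.
    by apply: eq_digraph => e; rewrite !inE.
  rewrite ifT; last by apply/connect_symP=> x y; rewrite -!e_r adjacent_sym.
  by congr (_ ^+ _); apply/esym/(eq_n_comp e_r).
rewrite sumr_const; congr (_ *+ _).
have <- : #|predC1 (None : option bool)| = 2%N.
  by rewrite cardC1 card_option card_bool.
rewrite -(card_pffun_on None); apply: eq_card => f.
rewrite -[LHS]/([set e | f e] == A).
apply/eqP/pffun_onP => [<- | [/subsetP sfA fA]].
  split.
    by apply/subsetP=> e; rewrite !inE; case: (f e).
  by move=> l /mapP[e]; rewrite mem_enum !inE => fe ->; case: (f e) fe.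
apply/setP=> e; rewrite inE; apply/idP/idP => [fe | eA].
  by apply: sfA; rewrite inE; case: (f e) fe.
have := fA (f e) (image_f _ eA); rewrite inE.
by case: (f e).
Qed.

(** * Strong connectedness as reachability *)

(** No arc enters the source side of a directed cut, so nothing outside it
    reaches it; conversely the vertices that x does not reach are the source
    side of a directed cut, since an edge there that is not oriented outwards
    would extend the reach of x. *)
Lemma strongly_connectedP f :
  reflect (forall x y, connect (digraph (directions \o f)) x y)
          (strongly_connected f).
Proof.
set r := digraph _.
have arcP e : ((f e != Some false) -> r (end1 e) (end2 e))
            * ((f e != Some true) -> r (end2 e) (end1 e)).
  by split=> fe; apply/existsP; exists e; rewrite /= fe !eqxx ?orbT.
apply: (iffP idP) => [sc x y | conn].
  apply: contraTT sc => nxy; rewrite negbK.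
  pose X := [set z | ~~ connect r x z].
  apply/existsP; exists (cut X); apply/existsP; exists X.
  apply/and4P; split=> //; first by apply/set0Pn; exists y; rewrite inE.
    apply/properP; split; first exact: subsetT.
    by exists x; rewrite ?inE ?connect0.
  apply/forall_inP=> e; rewrite !inE /oriented_out /Defs.arc.
  have [fwd bwd] := arcP e.
  have {}fwd :
      (f e != Some false) ==> connect r x (end1 e) ==> connect r x (end2 e).
    by apply/implyP=> /fwd/connect1 e12; apply/implyP => /connect_trans->.
  have {}bwd :
      (f e != Some true) ==> connect r x (end2 e) ==> connect r x (end1 e).
    by apply/implyP=> /bwd/connect1 e21; apply/implyP => /connect_trans->.
  case: (f e) fwd bwd => [[]|] /=; rewrite ?inE;
    by case: (connect r x (end1 e)); case: (connect r x (end2 e)).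
apply/existsP=> -[C /existsP[X]].
case/and4P=> /set0Pn[y yX] XT /eqP-> /forall_inP out.
have [_ [x _ xX]] := properP XT.
have stays u v : r u v -> u \notin X -> v \notin X.
  move=> /existsP[e uv] uX; apply/negP=> vX.
  have eX : e \in cut X.
    by case/orP: uv => /andP[/andP[_ /eqP eu] /eqP ev];
      rewrite inE -eu -ev vX (negPf uX).
  move: (out e eX); rewrite /oriented_out /Defs.arc.
  case/orP: uv => /andP[/andP[/= fe /eqP eu] /eqP ev].
    by case: (f e) fe => [[]|] //= _; rewrite -eu (negPf uX).
  by case: (f e) fe => [[]|] //= _; rewrite -eu (negPf uX).
have /connectP[p] := conn x y.
elim: p x xX => [x xX _ /= yx | z p IHp x xX /= /andP[xz zp]].
  by rewrite yx (negPf xX) in yX.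
exact: IHp (stays _ _ xz xX) zp.
Qed.

(** In a connected graph symmetric reachability is already total, because each
    edge can be traversed in some direction. *)
Lemma class_sign_orientation f : connected G ->
  class_sign R (digraph (directions \o f)) = - (strongly_connected f)%:R.
Proof.
case/andP=> /card_gt0P[x0 _] /'forall_forallP G_conn; rewrite /class_sign.
set r := digraph _.
case: strongly_connectedP => [sc | nsc].
  rewrite ifT; last by apply/connect_symP => x y; rewrite !sc.
  have r_sym : connect_sym r by move=> x y; rewrite !sc.
  suff -> : n_comp r V = 1%N by rewrite expr1.
  rewrite -(n_comp_connect r_sym x0); apply: eq_n_comp_r => y.
  by rewrite -!topredE /= sc.
rewrite oppr0 ifF //; apply/negP=> /connect_symP r_sym; case: nsc => x y.
apply: connect_sub (G_conn x y) => {x y} x y /existsP[e /andP[_ xy]].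
suff /orP[/connect1 // | /connect1] : r x y || r y x by rewrite r_sym.
have traversable : r (end1 e) (end2 e) || r (end2 e) (end1 e).
  rewrite /r /digraph; apply/orP; case fe: (f e == Some false).
    by right; apply/existsP; exists e; rewrite /= (eqP fe) !eqxx.
  by left; apply/existsP; exists e; rewrite /= fe !eqxx.
by case/orP: xy => /andP[/eqP <- /eqP <-]; rewrite // orbC.
Qed.

End Digraphs.

(** * The Tutte evaluation *)

Theorem theorem2p2 (G : multigraph) (hG : connected G) :
  #|[set o : partial_orientation G | strongly_connected o]|%:R
    = 2%:R ^+ (#|vertex G| - 1) * (tutte_poly G rat).[1 / 2%:R, 3%:R] :> rat.
Proof.
have V_gt0 : (0 < #|vertex G|)%N by case/andP: hG.
transitivity (- \sum_(o : partial_orientation G)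
                  class_sign rat (digraph (directions \o o))).
  under eq_bigr => o _ do rewrite class_sign_orientation //.
  rewrite sumrN opprK -sum1_card natr_sum.
  rewrite big_mkcond; apply: eq_bigr => o _; rewrite inE.
  by case: strongly_connected.
rewrite sum_class_sign_directions sum_class_sign_presence.
rewrite /tutte_poly !horner_sum mulr_sumr -sumrN; apply: eq_bigr => A _.
rewrite /rank (num_components_connected hG).
move: (num_components_gt0 A V_gt0) (num_components_le A) (card_vertex_le A).
set k := num_components A; set n := #|vertex G|; set m := #|A|.
move=> k_gt0 le_kn le_n.
rewrite !hornerE /=.
have -> : (n - 1 - (n - k) = k.-1)%N by lia.
have -> : 3%:R - 1 = 2%:R :> rat by [].
have -> : 2%:R^-1 - 1 = - 2%:R^-1 :> rat by [].
rewrite -mulr_natr natrX -(prednK k_gt0) exprS mulN1r mulNr opprK.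
rewrite (exprNn 2%:R^-1) mulrAC -exprD [RHS]mulrCA; congr (_ * _).
have -> : (n - 1 + (m - (n - k.-1.+1)) = m + k.-1)%N by lia.
by rewrite exprD exprVn mulfK // expf_neq0.
Qed.
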